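(* Let $k>1$ be an integer. Then all positive integer solutions $(x,y)$ of the equation $x^{2}-(k^{2}-1)y^{2}=4$ are given by $$(x,y)=\left(V_{n}(2k,-1),2U_{n}(2k,-1)\right)$$ with $n\geq 1$. That is, the set of pairs of positive integers solving the equation is exactly the set of these pairs as $n$ ranges over the integers $n\ge 1$.
   Context: For nonzero integers $m,s$ with $m^{2}+4s>0$, the generalized Fibonacci sequence is defined by $U_{0}(m,s)=0$, $U_{1}(m,s)=1$, $U_{n+1}(m,s)=mU_{n}(m,s)+sU_{n-1}(m,s)$ for $n\ge 1$, and the generalized Lucas sequence by $V_{0}(m,s)=2$, $V_{1}(m,s)=m$, $V_{n+1}(m,s)=mV_{n}(m,s)+sV_{n-1}(m,s)$ for $n\ge 1$. *)

(* Defs.v *)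
From mathcomp Require Import all_boot all_order all_algebra.
Set Implicit Arguments.
Unset Strict Implicit.
Unset Printing Implicit Defensive.
Import Order.TTheory GRing.Theory Num.Theory.
Local Open Scope ring_scope.

(* Both sequences are total in (m, s); they are only meant to be used when
   m and s are nonzero and m ^+ 2 + 4 * s > 0, which holds for
   (m, s) = (2 * k, -1) as soon as k > 1. *)
Fixpoint fibU (m s : int) (n : nat) : int :=
  match n with
  | 0%N => 0
  | n1.+1 => match n1 with
             | 0%N => 1
             | n0.+1 => m * fibU m s n1 + s * fibU m s n0
             end
  end.

Fixpoint lucV (m s : int) (n : nat) : int :=
  match n with
  | 0%N => 2
  | n1.+1 => match n1 with
             | 0%N => m
             | n0.+1 => m * lucV m s n1 + s * lucV m s n0
             end
  end.

(* Main.v *)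
Require Import Defs.
From mathcomp Require Import all_boot all_order all_algebra.
From mathcomp Require Import zify ring.
Set Implicit Arguments.
Unset Strict Implicit.
Unset Printing Implicit Defensive.
Import Order.TTheory GRing.Theory Num.Theory.
Local Open Scope ring_scope.

(** Write [d = k ^+ 2 - 1].  The element [k + sqrt d] has norm 1, so
    multiplication by it maps a solution of [x ^+ 2 - d * y ^+ 2 = 4], read as
    [x + y * sqrt d], to another solution, and multiplication by its conjugate
    [k - sqrt d] undoes this.  Since [k + sqrt d] is a root of
    [X ^+ 2 - 2 * k * X + 1], the orbit of the trivial solution [(2, 0)] obeys
    the recurrence with parameters [(2 * k, -1)]: it consists of the pairs
    [(V_n, 2 * U_n)] ([lucV_fibU_step]).  Hence all these pairs are solutions.

    Conversely, Fermat descent with [k - sqrt d] replaces a positive solution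
    with [y > 2] by a positive one with smaller [y] ([pell4_descent]).
    It ends at [y <= 2], where [(2 * k, 2)], the pair of index 1, is the only
    possibility ([pell4_base]): for [y = 1] one would need [x ^+ 2 = k ^+ 2 + 3],
    which lies strictly between two consecutive squares. *)

(** These are the two coordinates of
    [V_(n+1) + 2 * U_(n+1) * sqrt d = (k + sqrt d) * (V_n + 2 * U_n * sqrt d)];
    unlike the defining recurrences, they are of order one, and so can be
    inverted in the descent. *)
Lemma lucV_fibU_step (k : int) (n : nat) :
  lucV (2 * k) (-1) n.+1 =
    k * lucV (2 * k) (-1) n + (k ^+ 2 - 1) * (2 * fibU (2 * k) (-1) n) /\
  2 * fibU (2 * k) (-1) n.+1 =
    k * (2 * fibU (2 * k) (-1) n) + lucV (2 * k) (-1) n.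
Proof.
elim: n => [|n [IHV IHU]]; first by split=> /=; ring.
have -> : lucV (2 * k) (-1) n.+2 =
  2 * k * lucV (2 * k) (-1) n.+1 + -1 * lucV (2 * k) (-1) n by [].
have -> : fibU (2 * k) (-1) n.+2 =
  2 * k * fibU (2 * k) (-1) n.+1 + -1 * fibU (2 * k) (-1) n by [].
split; first by rewrite IHU IHV; ring.
rewrite mulrDr [2 * (2 * k * _)]mulrCA IHU IHV; ring.
Qed.

Lemma lucV_fibU_pell4 (k : int) (n : nat) :
  lucV (2 * k) (-1) n ^+ 2 - (k ^+ 2 - 1) * (2 * fibU (2 * k) (-1) n) ^+ 2 = 4.
Proof.
elim: n => [|n IHn]; first by rewrite /=; ring.
have [-> ->] := lucV_fibU_step k n.
rewrite -[RHS]IHn; ring.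
Qed.

Lemma lucV_fibU_gt0 (k : int) (n : nat) : 1 < k ->
  0 < lucV (2 * k) (-1) n.+1 /\ 0 < 2 * fibU (2 * k) (-1) n.+1.
Proof.
move=> hk; elim: n => [|n [V_gt0 U_gt0]]; first by split=> /=; lia.
have [-> ->] := lucV_fibU_step k n.+1.
have d_gt0 : 0 < k ^+ 2 - 1 by nia.
have k_gt0 : 0 < k by lia.
by split; apply: addr_gt0 => //; apply: mulr_gt0.
Qed.

Lemma pell4_base (k x y : int) : 1 < k -> 0 < x -> 0 < y -> y <= 2 ->
  x ^+ 2 - (k ^+ 2 - 1) * y ^+ 2 = 4 -> x = 2 * k /\ y = 2.
Proof.
move=> hk x_gt0 y_gt0 y_le2 exy.
have [y1|y2] : y = 1 \/ y = 2 by lia.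
  have lt_kx : k < x by nia.
  have lt_xk : x < k + 1 by nia.
  lia.
split=> //; apply/eqP; rewrite -(@eqrXn2 _ 2) //; [|lia..].
apply/eqP; nia.
Qed.

(** The new pair is [(k - sqrt d) * (x + y * sqrt d)].  The bounds hold because
    [x ^+ 2 = d * y ^+ 2 + 4] lies strictly between [((k - 1) * y) ^+ 2] and,
    as soon as [y > 2], [(k * y) ^+ 2]. *)
Lemma pell4_descent (k x y : int) : 1 < k -> 0 < x -> 2 < y ->
  x ^+ 2 - (k ^+ 2 - 1) * y ^+ 2 = 4 ->
  let x' := k * x - (k ^+ 2 - 1) * y in
  let y' := k * y - x in
  [/\ 0 < x', 0 < y', y' < y & x' ^+ 2 - (k ^+ 2 - 1) * y' ^+ 2 = 4].
Proof.
move=> hk x_gt0 y_gt2 exy x' y'.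
have x2E : x ^+ 2 = (k ^+ 2 - 1) * y ^+ 2 + 4 by rewrite -exy; ring.
have y2_gt4 : 4 < y ^+ 2 by nia.
have lt_x : (k - 1) * y < x.
  rewrite -ltr_sqr ?nnegrE; [|nia..].
  rewrite x2E exprMn; nia.
have lt_ky : x < k * y.
  rewrite -ltr_sqr ?nnegrE; [|nia..].
  rewrite x2E exprMn; lia.
split.
- (* [d * y = (k + 1) * ((k - 1) * y)] is too large to be compared with [k * x]
     through the bound on [(k - 1) * y]; the squares differ by
     [d * y ^+ 2 + 4 * k ^+ 2]. *)
  rewrite subr_gt0 -ltr_sqr ?nnegrE; [|nia..].
  rewrite !exprMn x2E -subr_gt0.
  have -> : k ^+ 2 * ((k ^+ 2 - 1) * y ^+ 2 + 4) - (k ^+ 2 - 1) ^+ 2 * y ^+ 2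
     = (k ^+ 2 - 1) * y ^+ 2 + 4 * k ^+ 2 by ring.
  have d_gt0 : 0 < k ^+ 2 - 1 by nia.
  by apply: addr_gt0; nia.
- by rewrite subr_gt0.
- rewrite /y'; lia.
- rewrite -[RHS]exy /x' /y'; ring.
Qed.

Lemma pell4_complete (k x y : int) : 1 < k -> 0 < x -> 0 < y ->
  x ^+ 2 - (k ^+ 2 - 1) * y ^+ 2 = 4 ->
  exists n : nat, (1 <= n)%N /\
    (x, y) = (lucV (2 * k) (-1) n, 2 * fibU (2 * k) (-1) n).
Proof.
move=> hk; have [N] := ubnP `|y|%N.
elim: N x y => // N IHN x y le_yN x_gt0 y_gt0 exy.
have [y_le2|y_gt2] := lerP y 2.
  have [-> ->] := pell4_base hk x_gt0 y_gt0 y_le2 exy.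
  by exists 1%N.
have [x'_gt0 y'_gt0 lt_y' exy'] := pell4_descent hk x_gt0 y_gt2 exy.
have [|n [_ [eV eU]]] := IHN _ _ _ x'_gt0 y'_gt0 exy'; first by lia.
exists n.+1; split=> //.
have [-> ->] := lucV_fibU_step k n.
by rewrite -eV -eU; congr pair; ring.
Qed.

Theorem theorem20 (k : int) (hk : 1 < k) (x y : int) :
  (0 < x /\ 0 < y /\ x ^+ 2 - (k ^+ 2 - 1) * y ^+ 2 = 4) <->
  (exists n : nat, (1 <= n)%N /\
     (x, y) = (lucV (2 * k) (-1) n, 2 * fibU (2 * k) (-1) n)).
Proof.
split=> [[x_gt0 [y_gt0 exy]]|[[|n] [// _ [-> ->]]]].
  exact: pell4_complete.
have [V_gt0 U_gt0] := lucV_fibU_gt0 n hk.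
by split; [|split; [|exact: (lucV_fibU_pell4 k n.+1)]].
Qed.
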